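(* Let $K\to R$ be a homomorphism of commutative rings, and let $U$ and $V$ be two $R$-modules. Let $R\to S$ be a flat epimorphism of commutative rings and $D_R\colon U\to V$ be a $K$-linear quite $R$-differential operator of ordinal order $\alpha$. Then there exists a unique $K$-linear quite $S$-differential operator $D_S\colon S\otimes_RU\to S\otimes_RV$ such that $D_S(1\otimes u)=1\otimes D_R(u)$ for all $u\in U$ (that is, $D_R$ and $D_S$ form a commutative square with the natural maps $U\to S\otimes_RU$ and $V\to S\otimes_RV$). The ordinal order of the differential operator $D_S$ does not exceed $\alpha$.
   Context: For a homomorphism of commutative rings $K\to R$ and $R$-modules $U$, $V$, the group $E=\mathrm{Hom}_K(U,V)$ is an $R$-$R$-bimodule: $(re)(u)=r\,e(u)$, $(er)(u)=e(ru)$. Define by transfinite induction $F_0E=\{e\in E\mid re-er=0\ \forall r\in R\}$ and $F_\alpha E=\{e\in E\mid re-er\in\bigcup_{\beta<\alpha}F_\beta E\ \forall r\in R\}$ for every ordinal $\alpha>0$. A $K$-linear map $e\colon U\to V$ is a $K$-linear quite $R$-differential operator if $e\in F_\beta E$ for some ordinal $\beta$; its ordinal order is the smallest such $\beta$ if $e\ne0$ (the zero map is regarded as having order $-1$, smaller than all ordinals). So the ordinal order does not exceed $\alpha$ if and only if $e\in F_\alpha E$. The same definition with $S$ in place of $R$ (using the composition $K\to R\to S$) gives quite $S$-differential operators between $S$-modules. A flat epimorphism of commutative rings $R\to S$ is an epimorphism in the category of commutative rings such that $S$ is a flat $R$-module. *)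

(* Defs.v *)
From HB Require Import structures.
From mathcomp Require Import all_boot all_order all_algebra.
From mathcomp Require Import boolp wochoice.
From mathcomp Require Import freeg.
From mathcomp Require ring_quotient.

Set Implicit Arguments.
Unset Strict Implicit.
Unset Printing Implicit Defensive.

Import Order.TTheory GRing.Theory.
Local Open Scope ring_scope.
Local Open Scope quotient_scope.

Definition restrict (K R : comPzRingType) (f : {rmorphism K -> R})
  (U : lmodType R) : Type := U.

Section Restrict.
Variables (K R : comPzRingType) (f : {rmorphism K -> R}) (U : lmodType R).

HB.instance Definition _ := GRing.Zmodule.on (restrict f U).

Definition restrict_scale (k : K) (u : restrict f U) : restrict f U :=
  f k *: (u : U).

Fact restrict_scaleA k l u :
  restrict_scale k (restrict_scale l u) = restrict_scale (k * l) u.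
Proof. by rewrite /restrict_scale scalerA rmorphM. Qed.

Fact restrict_scale1 : left_id 1 restrict_scale.
Proof. by move=> u; rewrite /restrict_scale rmorph1 scale1r. Qed.

Fact restrict_scaleDr : right_distributive restrict_scale +%R.
Proof. by move=> k u v; rewrite /restrict_scale scalerDr. Qed.

Fact restrict_scaleDl u : {morph restrict_scale^~ u : k l / k + l}.
Proof. by move=> k l; rewrite /restrict_scale rmorphD scalerDl. Qed.

HB.instance Definition _ := GRing.Zmodule_isLmodule.Build K (restrict f U)
  restrict_scaleA restrict_scale1 restrict_scaleDr restrict_scaleDl.

Lemma restrict_scaleE (k : K) (u : restrict f U) : k *: u = f k *: (u : U).
Proof. by []. Qed.

End Restrict.

(* [tensor M N] is the free abelian group on [M * N] modulo the subgroup
   [tensor_rel M N] generated by the bilinearity relations. *)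

Section Tensor.
Variables (R : comPzRingType) (M N : lmodType R).

Local Notation free := {freeg (M * N)%type / int}.
Local Notation gen m n := (<< 1 *g (m, n) >> : free).

Inductive tensor_rel : free -> Prop :=
| tensor_rel_addl m m' n :
    tensor_rel (gen (m + m') n - gen m n - gen m' n)
| tensor_rel_addr m n n' :
    tensor_rel (gen m (n + n') - gen m n - gen m n')
| tensor_rel_scale r m n :
    tensor_rel (gen (r *: m) n - gen m (r *: n))
| tensor_rel0 : tensor_rel 0
| tensor_relB x y : tensor_rel x -> tensor_rel y -> tensor_rel (x - y).

Definition tensor_relb : pred free := fun x => `[< tensor_rel x >].

Fact tensor_relb_closed : zmod_closed tensor_relb.
Proof.
split=> [|x y /asboolP xr /asboolP yr]; apply/asboolP; first exact: tensor_rel0.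
exact: tensor_relB.
Qed.

HB.instance Definition _ := GRing.isZmodClosed.Build free tensor_relb
  tensor_relb_closed.

Local Notation rel_closed := (GRing.ZmodClosed.clone free tensor_relb _).
Local Notation quot := (ring_quotient.Quotient.quot rel_closed).

Definition tensor : Type := quot.

HB.instance Definition _ := GRing.Zmodule.on tensor.

Definition tens (m : M) (n : N) : tensor := \pi_(quot) (gen m n).

Let pi_eq (x y : free) : tensor_rel (x - y) -> \pi_(quot) x = \pi_(quot) y.
Proof.
move=> xy; apply/eqP; rewrite -ring_quotient.Quotient.idealrBE.
exact/asboolP.
Qed.

Lemma tensDl n : {morph tens^~ n : m m' / m + m'}.
Proof.
move=> m m'; rewrite /tens -[RHS](raddfD \pi_(quot)); apply: pi_eq.
by rewrite opprD addrA; apply: tensor_rel_addl.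
Qed.

Lemma tensDr m : {morph tens m : n n' / n + n'}.
Proof.
move=> n n'; rewrite /tens -[RHS](raddfD \pi_(quot)); apply: pi_eq.
by rewrite opprD addrA; apply: tensor_rel_addr.
Qed.

Lemma tensZ r m n : tens (r *: m) n = tens m (r *: n).
Proof. exact/pi_eq/tensor_rel_scale. Qed.

Lemma tensor_ind (P : tensor -> Prop) :
  (forall m n, P (tens m n)) -> (forall x y, P x -> P y -> P (x - y)) ->
  forall x, P x.
Proof.
move=> Pt PB; have P0 : P 0 by rewrite -(subrr (tens 0 0)); apply: PB.
have PN x : P x -> P (- x) by move=> Px; rewrite -sub0r; apply: PB.
have PD x y : P x -> P y -> P (x + y).
  by move=> Px Py; rewrite -[y]opprK; apply: PB => //; apply: PN.
elim/quotW; elim/freeg_ind_dom0 => [|k [m n] D _ _ PD'].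
  by rewrite (raddf0 \pi_(quot)).
rewrite (raddfD \pi_(quot)); apply: (PD) => //.
have -> : << k *g (m, n) >> = gen m n *~ k by rewrite freeg_mulz intz.
rewrite (raddfMz \pi_(quot)) -/(tens m n).
have Pnat j : P (tens m n *+ j).
  by elim: j => [|j IH]; rewrite ?mulr0n // mulrS; apply: (PD).
by case: k => j; [apply: Pnat | apply/PN/Pnat].
Qed.

Section Lift.
Variables (A : zmodType) (b : M -> N -> A).

Definition tensor_lift (x : tensor) : A :=
  fglift (fun p : M * N => b p.1 p.2 : zmodule A) (repr (x : quot)).

Hypothesis bDl : forall n, {morph b^~ n : m m' / m + m'}.
Hypothesis bDr : forall m, {morph b m : n n' / n + n'}.
Hypothesis bZ : forall r m n, b (r *: m) n = b m (r *: n).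

Let lift0 := fglift (fun p : M * N => b p.1 p.2 : zmodule A).

Let lift0B (x y : free) : lift0 (x - y) = lift0 x - lift0 y.
Proof. exact: lift_is_additive. Qed.

Let lift0E m n : lift0 (gen m n) = b m n.
Proof. by rewrite /lift0 liftU scale1r. Qed.

Let lift0_rel x : tensor_rel x -> lift0 x = 0.
Proof.
elim=> [m m' n|m n n'|r m n||y z _ y0 _ z0]; rewrite ?lift0B ?lift0E.
- by rewrite bDl addrAC addrK subrr.
- by rewrite bDr addrAC addrK subrr.
- by rewrite bZ subrr.
- by rewrite -(subrr 0) lift0B subrr.
- by rewrite y0 z0 subr0.
Qed.

Let tensor_lift_pi x : tensor_lift (\pi_(quot) x) = lift0 x.
Proof.
apply/eqP; rewrite -subr_eq0 -lift0B; apply/eqP/lift0_rel/asboolP.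
have := ring_quotient.Quotient.idealrBE
  rel_closed (repr (\pi_(quot) x)) x.
by rewrite reprK eqxx.
Qed.

Lemma tensor_liftE m n : tensor_lift (tens m n) = b m n.
Proof. by rewrite tensor_lift_pi lift0E. Qed.

Lemma tensor_lift_is_additive : zmod_morphism tensor_lift.
Proof.
elim/quotW=> x; elim/quotW=> y.
by rewrite -(raddfB \pi_(quot)) !tensor_lift_pi lift0B.
Qed.

End Lift.

End Tensor.

Arguments tens {R M N}.
Arguments tensor_lift {R M N A}.

Section TensorMap.
Variables (R : comPzRingType) (M M' N N' : lmodType R).
Variables (f : {linear M -> M'}) (g : {linear N -> N'}).

Definition tensor_map : tensor M N -> tensor M' N' :=
  tensor_lift (fun m n => tens (f m) (g n)).

Let mapDl n : {morph (fun m => tens (f m) (g n)) : m m' / m + m'}.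
Proof. by move=> m m'; rewrite raddfD tensDl. Qed.

Let mapDr m : {morph (fun n => tens (f m) (g n)) : n n' / n + n'}.
Proof. by move=> n n'; rewrite raddfD tensDr. Qed.

Let mapZ r m n : tens (f (r *: m)) (g n) = tens (f m) (g (r *: n)).
Proof. by rewrite !linearZ tensZ. Qed.

Lemma tensor_mapE m n : tensor_map (tens m n) = tens (f m) (g n).
Proof. exact: tensor_liftE. Qed.

Fact tensor_map_is_additive : zmod_morphism tensor_map.
Proof. exact: tensor_lift_is_additive. Qed.

HB.instance Definition _ := GRing.isZmodMorphism.Build (tensor M N)
  (tensor M' N') tensor_map tensor_map_is_additive.

End TensorMap.

Definition base_change (R S : comPzRingType) (phi : {rmorphism R -> S})
  (U : lmodType R) : Type := tensor (restrict phi S^o) U.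

Section BaseChange.
Variables (R S : comPzRingType) (phi : {rmorphism R -> S}) (U : lmodType R).

HB.instance Definition _ := GRing.Zmodule.on (base_change phi U).

Definition base_mul (s s' : restrict phi S^o) : restrict phi S^o :=
  (s : S) * (s' : S).

Fact base_mul_is_linear s : linear (base_mul s).
Proof.
move=> r x y; rewrite !restrict_scaleE /base_mul mulrDr; congr (_ + _).
exact: mulrCA.
Qed.

HB.instance Definition _ s :=
  GRing.isLinear.Build R (restrict phi S^o) (restrict phi S^o) _
    (base_mul s) (base_mul_is_linear s).

Definition btens (s : S) (u : U) : base_change phi U :=
  tens (s : restrict phi S^o) u.

Definition base_scale (s : S) (x : base_change phi U) : base_change phi U :=
  tensor_map (base_mul s) idfun x.

Lemma base_scaleE s s' u : base_scale s (btens s' u) = btens (s * s') u.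
Proof. exact: tensor_mapE. Qed.

Lemma base_change_ind (P : base_change phi U -> Prop) :
  (forall s u, P (btens s u)) -> (forall x y, P x -> P y -> P (x - y)) ->
  forall x, P x.
Proof. by move=> Pt PB x; apply: (@tensor_ind _ _ _ P Pt PB x). Qed.

Fact base_scaleB s : zmod_morphism (base_scale s).
Proof. exact: (tensor_map_is_additive (base_mul s) idfun). Qed.

Fact base_scaleA s t x : base_scale s (base_scale t x) = base_scale (s * t) x.
Proof.
move: x; apply: base_change_ind => [s' u|x y IHx IHy].
  by rewrite !base_scaleE mulrA.
by rewrite !base_scaleB IHx IHy.
Qed.

Fact base_scale1 : left_id 1 base_scale.
Proof.
apply: base_change_ind => [s u|x y IHx IHy]; first by rewrite base_scaleE mul1r.
by rewrite base_scaleB IHx IHy.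
Qed.

Fact base_scaleDr : right_distributive base_scale +%R.
Proof. by move=> s; apply: (raddfD (tensor_map (base_mul s) idfun)). Qed.

Fact base_scaleDl x : {morph base_scale^~ x : s t / s + t}.
Proof.
move=> s t; move: x; apply: base_change_ind => [s' u|x y IHx IHy].
  by rewrite !base_scaleE mulrDl; apply: tensDl.
by rewrite !base_scaleB IHx IHy opprD addrACA.
Qed.

HB.instance Definition _ := GRing.Zmodule_isLmodule.Build S (base_change phi U)
  base_scaleA base_scale1 base_scaleDr base_scaleDl.

Lemma scale_btens s s' u : s *: btens s' u = btens (s * s') u.
Proof. exact: base_scaleE. Qed.

End BaseChange.

Arguments btens {R S} phi {U}.

Definition flat (R : comPzRingType) (M : lmodType R) : Prop :=
  forall (N N' : lmodType R) (j : {linear N -> N'}),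
    injective j -> injective (tensor_map (idfun : {linear M -> M}) j).

Definition ring_epi (R S : comPzRingType) (phi : {rmorphism R -> S}) : Prop :=
  forall (T : comPzRingType) (g h : {rmorphism S -> T}),
    g \o phi =1 h \o phi -> g =1 h.

Definition flat_epi (R S : comPzRingType) (phi : {rmorphism R -> S}) : Prop :=
  ring_epi phi /\ flat (restrict phi S^o).

Section DiffOp.
Variables (K R : comPzRingType) (f : {rmorphism K -> R}) (U V : lmodType R).

Definition homK : Type := {linear restrict f U -> restrict f V}.

(* [r e - e r], with [(r e) u = r *: e u] and [(e r) u = e (r *: u)]. *)
Definition commutator (r : R) (e : homK) (u : restrict f U) : restrict f V :=
  (r *: (e u : V) : V) - e (r *: (u : U) : U).

Fact commutator_is_linear r e : linear (commutator r e).
Proof.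
move=> k x y; rewrite /commutator.
have -> : r *: (k *: x + y : U) =
    k *: (r *: (x : U) : restrict f U) + r *: (y : U) :> U.
  by rewrite scalerDr !restrict_scaleE !scalerA mulrC.
rewrite !(linearP e).
have comm (c : R) (a b p q : V) :
    r *: (c *: a + b) - (c *: p + q) = c *: (r *: a - p) + (r *: b - q).
  by rewrite scalerBr scalerDr opprD addrACA !scalerA [r * _]mulrC.
exact: (comm (f k)).
Qed.

HB.instance Definition _ r e :=
  GRing.isLinear.Build K (restrict f U) (restrict f V) _
    (commutator r e) (commutator_is_linear r e).

(* Ordinals are elements [a] of a well-ordered type [W], such an [a] standing
   for the order type of its initial segment: the ordinals smaller than [a]
   are the [b : W] with [b < a], and 0 is the element with nothing below it. *)
Inductive diff_filt (d : Order.disp_t) (W : orderType d) :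
    W -> homK -> Prop :=
| diff_filt0 a e : (forall b : W, ~ (b < a)%O) ->
    (forall r u, commutator r e u = 0) -> diff_filt a e
| diff_filtS a e : (exists b : W, (b < a)%O) ->
    (forall r, exists2 b : W, (b < a)%O & diff_filt b (commutator r e)) ->
    diff_filt a e.

Definition quite_diff_op (e : homK) : Prop :=
  exists (d : Order.disp_t) (W : orderType d),
    well_order (<=%O : rel W) /\ exists b : W, diff_filt b e.

(* [None] is the order [-1] of the zero map. *)
Definition has_order (d : Order.disp_t) (W : orderType d) (e : homK)
    (o : option W) : Prop :=
  if o is Some a then
    [/\ exists u, e u != 0, diff_filt a e &
        forall b : W, diff_filt b e -> (a <= b)%O]
  else forall u, e u = 0.

End DiffOp.

Definition order_le (d : Order.disp_t) (W : orderType d)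
    (o1 o2 : option W) : bool :=
  match o1, o2 with
  | None, _ => true
  | Some _, None => false
  | Some a, Some b => (a <= b)%O
  end.

(* Main.v *)
Require Import Defs.
From HB Require Import structures.
From mathcomp Require Import all_boot all_order all_algebra.
From mathcomp Require Import boolp wochoice.
From mathcomp Require ring_quotient.

Set Implicit Arguments.
Unset Strict Implicit.
Unset Printing Implicit Defensive.

Import Order.TTheory GRing.Theory.
Local Open Scope ring_scope.

(* Over a flat epimorphism [phi : R -> S], for every [s : S] the [r : R] such
   that [phi r * s] lies in the image of [R] generate the unit ideal of [S],
   and so does the annihilator of every [c : R] with [phi c = 0]. The
   extension [E] of [e] is built by induction on its order: the commutators
   [[r, e]] have extensions [D r] of smaller order, and if
   [phi r * s = phi a] then [E (s ⊗ u)] has to satisfy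
   [r E (s ⊗ u) = D r (s ⊗ u) + 1 ⊗ e (a u)]. These equations have exactly
   one solution, and their compatibility reduces to
   [[phi r, D c] = [phi c, D r]], which follows from uniqueness of extensions.
   Uniqueness itself holds because an operator vanishing on [1 ⊗ U] has, by
   induction, vanishing commutators with [R], so that it is [R]-linear, hence
   [S]-linear since [phi] is an epimorphism. *)

(** * The ring S ⊗_R S and epimorphisms *)

Section TensorSquare.
Variables (R S : comPzRingType) (phi : {rmorphism R -> S}).
Local Notation RS := (restrict phi S^o).

Definition tensor_square : Type := tensor RS RS.
HB.instance Definition _ := GRing.Zmodule.on tensor_square.

Implicit Types (x y z : tensor_square) (s t : RS).

Definition tsq (s t : RS) : tensor_square := tens s t.

Lemma tsq_ind (P : tensor_square -> Prop) :
  (forall s t, P (tsq s t)) -> (forall x y, P x -> P y -> P (x - y)) ->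
  forall x, P x.
Proof. exact: tensor_ind. Qed.

Definition tsq_scale s t : tensor_square -> tensor_square :=
  tensor_map (base_mul s) (base_mul t).

Lemma tsq_scaleE s t s' t' :
  tsq_scale s t (tsq s' t') = tsq (base_mul s s') (base_mul t t').
Proof. exact: tensor_mapE. Qed.

Lemma tsq_scaleB s t : {morph tsq_scale s t : x y / x - y}.
Proof. exact: (raddfB (tensor_map (base_mul s) (base_mul t))). Qed.

Lemma tsq_scaleDl t x : {morph tsq_scale^~ t ^~ x : s s' / s + s'}.
Proof.
move=> s s'; elim/tsq_ind: x => [a b|x y IHx IHy].
  by rewrite !tsq_scaleE /base_mul mulrDl; apply: tensDl.
by rewrite !tsq_scaleB IHx IHy opprD addrACA.
Qed.

Lemma tsq_scaleDr s x : {morph (tsq_scale s)^~ x : t t' / t + t'}.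
Proof.
move=> t t'; elim/tsq_ind: x => [a b|x y IHx IHy].
  by rewrite !tsq_scaleE /base_mul mulrDl; apply: tensDr.
by rewrite !tsq_scaleB IHx IHy opprD addrACA.
Qed.

Lemma tsq_scaleZ x r s t : tsq_scale (r *: s) t x = tsq_scale s (r *: t) x.
Proof.
elim/tsq_ind: x => [a b|x y IHx IHy]; last by rewrite !tsq_scaleB IHx IHy.
rewrite !tsq_scaleE.
have comm (c d : RS) : base_mul (r *: c) d = r *: base_mul c d.
  exact/esym/mulrA.
by rewrite !comm; apply: tensZ.
Qed.

(** The product is lifted in its first factor: [tsq s t] acts by a [tensor_map], and this action is
    balanced in [s] and [t]. *)
Definition tsq_mul x y : tensor_square :=
  tensor_lift (fun s t => tsq_scale s t y) x.

Lemma tsq_mul_scale s t y : tsq_mul (tsq s t) y = tsq_scale s t y.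
Proof.
apply: tensor_liftE => *; [exact: tsq_scaleDl|exact: tsq_scaleDr|].
exact: tsq_scaleZ.
Qed.

Lemma tsq_mulBl y : {morph tsq_mul^~ y : x x' / x - x'}.
Proof.
apply: tensor_lift_is_additive => *; [exact: tsq_scaleDl|exact: tsq_scaleDr|].
exact: tsq_scaleZ.
Qed.

Lemma tsq_mulBr x : {morph tsq_mul x : y y' / y - y'}.
Proof.
move=> y y'; elim/tsq_ind: x => [s t|x x' IHx IHx'].
  by rewrite !tsq_mul_scale tsq_scaleB.
by rewrite !tsq_mulBl IHx IHx' !opprD addrACA.
Qed.

Lemma tsq_mulE s t s' t' :
  tsq_mul (tsq s t) (tsq s' t') = tsq (base_mul s s') (base_mul t t').
Proof. by rewrite tsq_mul_scale tsq_scaleE. Qed.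

Fact tsq_mulC : commutative tsq_mul.
Proof.
move=> x y; elim/tsq_ind: x => [s t|x x' IHx IHx']; last first.
  by rewrite tsq_mulBl tsq_mulBr IHx IHx'.
elim/tsq_ind: y => [s' t'|y y' IHy IHy'].
  by rewrite !tsq_mulE /base_mul mulrC [t * _ : S]mulrC.
by rewrite tsq_mulBl tsq_mulBr IHy IHy'.
Qed.

Fact tsq_mulA : associative tsq_mul.
Proof.
move=> x y z; elim/tsq_ind: x => [s t|x x' IHx IHx']; last first.
  by rewrite !tsq_mulBl IHx IHx'.
elim/tsq_ind: y => [s' t'|y y' IHy IHy']; last first.
  by rewrite tsq_mulBl !tsq_mulBr tsq_mulBl IHy IHy'.
elim/tsq_ind: z => [s'' t''|z z' IHz IHz']; last first.
  by rewrite !tsq_mulBr IHz IHz'.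
by rewrite !tsq_mulE /base_mul !mulrA.
Qed.

Fact tsq_mul1 : left_id (tsq 1 1) tsq_mul.
Proof.
elim/tsq_ind => [s t|x y IHx IHy]; last by rewrite tsq_mulBr IHx IHy.
by rewrite tsq_mulE /base_mul !mul1r.
Qed.

Fact tsq_mulDl : left_distributive tsq_mul +%R.
Proof.
move=> x y z; have /= := tsq_mulBl z (x + y) y.
by rewrite addrK => ->; rewrite subrK.
Qed.

HB.instance Definition _ := GRing.Zmodule_isComPzRing.Build tensor_square
  tsq_mulA tsq_mulC tsq_mul1 tsq_mulDl.

Definition tsq_inl (s : S) : tensor_square := tsq s (1 : S).
Definition tsq_inr (s : S) : tensor_square := tsq (1 : S) s.

Fact tsq_inl_is_zmod_morphism : zmod_morphism tsq_inl.
Proof.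
by move=> s t; apply/eqP; rewrite eq_sym subr_eq -[eqbRHS]tensDl subrK.
Qed.

Fact tsq_inr_is_zmod_morphism : zmod_morphism tsq_inr.
Proof.
by move=> s t; apply/eqP; rewrite eq_sym subr_eq -[eqbRHS]tensDr subrK.
Qed.

Fact tsq_inl_is_monoid_morphism : monoid_morphism tsq_inl.
Proof.
split=> // s t; apply: esym; rewrite /GRing.mul /=.
by rewrite tsq_mulE /base_mul mulr1.
Qed.

Fact tsq_inr_is_monoid_morphism : monoid_morphism tsq_inr.
Proof.
split=> // s t; apply: esym; rewrite /GRing.mul /=.
by rewrite tsq_mulE /base_mul mulr1.
Qed.

HB.instance Definition _ := GRing.isZmodMorphism.Build S tensor_square
  tsq_inl tsq_inl_is_zmod_morphism.
HB.instance Definition _ := GRing.isMonoidMorphism.Build S tensor_square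
  tsq_inl tsq_inl_is_monoid_morphism.
HB.instance Definition _ := GRing.isZmodMorphism.Build S tensor_square
  tsq_inr tsq_inr_is_zmod_morphism.
HB.instance Definition _ := GRing.isMonoidMorphism.Build S tensor_square
  tsq_inr tsq_inr_is_monoid_morphism.

Hypothesis epi : ring_epi phi.

(** The two ring maps S → S ⊗ S agree on the image of R, hence everywhere. *)
Lemma epi_tens1 (s : S) : tens (s : RS) (1 : RS) = tens (1 : RS) (s : RS).
Proof.
apply: (@epi _ tsq_inl tsq_inr) => r /=.
have -> : phi r = (r *: (1 : RS)) :> RS by exact/esym/mulr1.
exact: tensZ.
Qed.

End TensorSquare.

(** The map s ⊗ t ↦ s D(t v) is R-balanced, so its lift takes equal values on s ⊗ 1 and 1 ⊗ s; these
    values are s D(v) and D(s v). *)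
Lemma epi_linear (R S : comPzRingType) (phi : {rmorphism R -> S})
  (epi : ring_epi phi) (M N : lmodType S) (D : M -> N) :
  zmod_morphism D -> (forall r v, D (phi r *: v) = phi r *: D v) ->
  scalable D.
Proof.
move=> DB Dphi s v.
have D0 : D 0 = 0 by rewrite -(subrr v) DB subrr.
have DN y : D (- y) = - D y by rewrite -sub0r DB D0 sub0r.
have DD y z : D (y + z) = D y + D z by rewrite -{1}[z]opprK DB DN opprK.
pose RS := restrict phi S^o.
pose b (s t : RS) : N := (s : S) *: D ((t : S) *: v).
have bE s' t' : tensor_lift b (tens s' t') = b s' t'.
  apply: tensor_liftE => [t u u'|t u u'|r t u]; rewrite /b.
  - by rewrite scalerDl.
  - by rewrite scalerDl DD scalerDr.
  - rewrite !restrict_scaleE /= -[in RHS]scalerA Dphi scalerA.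
    by rewrite [_ * phi r]mulrC.
have := bE 1 s; have := bE s 1; rewrite -(epi_tens1 epi) => -> /=.
by rewrite /b !scale1r => ->.
Qed.

(** * Ideals of S generated from R, and flatness *)

Section ExtendedIdeal.
Variables (R S : comPzRingType) (phi : {rmorphism R -> S}) (I : R -> Prop).

(** Generators carry a coefficient [t] in S, so closure under subtraction already yields the ideal
    generated by the image of [I]. *)
Inductive ext_ideal : S -> Prop :=
| ext_ideal_gen t r : I r -> ext_ideal (t * phi r)
| ext_ideal0 : ext_ideal 0
| ext_idealB x y : ext_ideal x -> ext_ideal y -> ext_ideal (x - y).

Definition ext_idealb : pred S := fun x => `[< ext_ideal x >].

Fact ext_idealb_closed : zmod_closed ext_idealb.
Proof.
split=> [|x y /asboolP xI /asboolP yI]; apply/asboolP; first exact: ext_ideal0.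
exact: ext_idealB.
Qed.

HB.instance Definition _ := GRing.isZmodClosed.Build S ext_idealb
  ext_idealb_closed.

Definition ext_quot : Type :=
  ring_quotient.Quotient.quot (GRing.ZmodClosed.clone S ext_idealb _).

HB.instance Definition _ := GRing.Zmodule.on ext_quot.

Definition ext_pi (s : S) : ext_quot :=
  (\pi_(ring_quotient.Quotient.quot
          (GRing.ZmodClosed.clone S ext_idealb _)) s)%qT.

Lemma ext_piD : {morph ext_pi : s t / s + t}.
Proof. exact: (raddfD (\pi_(_))%qT). Qed.

Lemma ext_pi_eq s t : ext_pi s = ext_pi t <-> ext_ideal (s - t).
Proof.
rewrite /ext_pi; split=> [/eqP|st].
  by rewrite -ring_quotient.Quotient.idealrBE => /asboolP.
by apply/eqP; rewrite -ring_quotient.Quotient.idealrBE; apply/asboolP.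
Qed.

End ExtendedIdeal.

Section SpanOfTwo.
Variables (R : comPzRingType) (M : lmodType R) (m p : M).

Definition span2 : pred M := fun x => `[< exists a b, x = a *: p + b *: m >].

Fact span2_closed : submod_closed span2.
Proof.
split=> [|c x y /asboolP[a [b ->]] /asboolP[a' [b' ->]]]; apply/asboolP.
  by exists 0, 0; rewrite !scale0r addr0.
exists (c * a + a'), (c * b + b').
by rewrite !scalerDl scalerDr !scalerA addrACA.
Qed.

HB.instance Definition _ := GRing.isSubmodClosed.Build R M span2 span2_closed.

Record span2_type := Span2 { span2_val :> M; _ : span2_val \in span2 }.

HB.instance Definition _ := [isSub for span2_val].
HB.instance Definition _ := [Choice of span2_type by <:].
HB.instance Definition _ := [SubChoice_isSubLmodule of span2_type by <:].

Lemma span2_coefP (x : span2_type) :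
  exists b, exists a, span2_val x = a *: p + b *: m.
Proof. by case: x => x /= /asboolP[a [b ->]]; exists b, a. Qed.

(** An arbitrary choice: the coefficient of [m] is determined only modulo the [b] with [b *: m] in
    [R p]. *)
Definition span2_coef (x : span2_type) : R := projT1 (cid (span2_coefP x)).

Lemma span2_coefE x : exists a, span2_val x = a *: p + span2_coef x *: m.
Proof. exact: (projT2 (cid (span2_coefP x))). Qed.

End SpanOfTwo.

Section Flat.
Variables (R S : comPzRingType) (phi : {rmorphism R -> S}).
Local Notation RS := (restrict phi S^o).
Hypothesis phi_flat : flat RS.

(* Flatness moves the equality [1 (x) m = s (x) p] into [S (x) (Rp + Rm)], on
   which the coefficient of [m] is well defined modulo the extended ideal. *)
Lemma flat_ext_ideal (M : lmodType R) (m p : M) (s : S) :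
  tens (1 : RS) m = tens (s : RS) p ->
  ext_ideal phi (fun b => exists a, b *: m = a *: p) 1.
Proof.
set I := (I in ext_ideal _ I _) => eq_mp.
pose N := span2_type m p.
pose b (t : RS) (x : N) := ext_pi phi I ((t : S) * phi (span2_coef x)).
(* For two expressions of [x], the difference of the coefficients of [m] sends [m] into [R p], so it
   lies in [I]. *)
have bE (t : RS) (x : N) a c : span2_val x = a *: p + c *: m ->
    b t x = ext_pi phi I ((t : S) * phi c).
  have [a' ->] := span2_coefE x => eq_ac; apply/ext_pi_eq.
  rewrite -mulrBr -rmorphB; apply: ext_ideal_gen.
  exists (a - a'); rewrite !scalerBl; apply/eqP.
  by rewrite subr_eq addrAC eq_sym subr_eq -eq_ac addrC.
have mN : m \in span2 m p.
  by apply/asboolP; exists 0, 1; rewrite scale0r scale1r add0r.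
have pN : p \in span2 m p.
  by apply/asboolP; exists 1, 0; rewrite scale0r scale1r addr0.
have liftE t x : tensor_lift b (tens t x) = b t x.
  apply: tensor_liftE => [y t1 t2|t1 y z|r t1 y].
  - by rewrite /b mulrDl ext_piD.
  - have [ay Ey] := span2_coefE y; have [az Ez] := span2_coefE z.
    rewrite (@bE _ _ (ay + az) (span2_coef y + span2_coef z)).
      by rewrite /b rmorphD mulrDr ext_piD.
    by rewrite !scalerDl addrACA -Ey -Ez.
  - have [ay Ey] := span2_coefE y.
    rewrite [RHS](@bE _ _ (r * ay) (r * span2_coef y)); last first.
      by rewrite -!scalerA -scalerDr -Ey.
    by rewrite rmorphM mulrA [_ * phi r]mulrC.
(* Flatness is applied to the inclusion of [N] in [M]; the lift of [b] then sends the two equal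
   tensors to the classes of 1 and 0. *)
have valI : injective (val : {linear N -> M}) by exact: val_inj.
have := phi_flat valI.
move=> /(_ (tens (1 : RS) (Span2 mN)) (tens (s : RS) (Span2 pN))).
rewrite !tensor_mapE => /(_ eq_mp) /(congr1 (tensor_lift b)).
rewrite !liftE (@bE _ _ 0 1) ?scale0r ?scale1r ?add0r //.
rewrite (@bE _ _ 1 0) ?scale0r ?scale1r ?addr0 // => /ext_pi_eq.
by rewrite rmorph0 rmorph1 mulr1 mulr0 subr0.
Qed.

(** The case M = R, m = c, p = 0, s = 0 of [flat_ext_ideal], since 1 ⊗ c = phi(c) ⊗ 1 = 0. *)
Lemma flat_ann (c : R) : phi c = 0 -> ext_ideal phi (fun x => x * c = 0) 1.
Proof.
move=> c0; have /flat_ext_ideal : tens (1 : RS) (c : R^o) = tens (0 : RS) 0.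
  rewrite -[c]mulr1 -[_ * _]/(c *: (1 : R^o)) -tensZ restrict_scaleE c0.
  rewrite scale0r; have := tensZ 0 (0 : RS) (1 : R^o).
  by rewrite !scale0r.
have -> // : (fun b : R => exists a : R, b *: (c : R^o) = a *: (0 : R^o)) =
  (fun x : R => x * c = 0).
apply/funext => x; apply/propext; split=> [[a]|xc]; first by rewrite scaler0.
by exists 0; rewrite scaler0.
Qed.

Hypothesis phi_epi : ring_epi phi.

(** The case M = S, m = s, p = 1 of [flat_ext_ideal], whose hypothesis is [epi_tens1]. *)
Lemma flat_epi_denom (s : S) :
  ext_ideal phi (fun r => exists a, phi r * s = phi a) 1.
Proof.
have /flat_ext_ideal : tens (1 : RS) (s : RS) = tens (s : RS) (1 : RS).
  exact/esym/epi_tens1.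
have -> // : (fun b : R => exists a : R, b *: (s : RS) = a *: (1 : RS)) =
  (fun r : R => exists a : R, phi r * s = phi a).
apply/funext => r; apply/propext; split=> -[a].
  by rewrite !restrict_scaleE [in RHS]/GRing.scale /= mulr1; exists a.
by exists a; rewrite !restrict_scaleE [in RHS]/GRing.scale /= mulr1.
Qed.

End Flat.

(** Proof irrelevance identifies the packed linearity proofs, so identities between operators can be
    used for rewriting. *)
Lemma linear_ext (K : pzRingType) (M N : lmodType K) (g h : {linear M -> N}) :
  g =1 h -> g = h.
Proof.
case: g h => g gL [h hL] /= /funext gh; subst h; congr (GRing.Linear.Pack _).
case: gL hL => -[gD] [gZ] [[hD] [hZ]].
by rewrite (Prop_irrelevance gD hD) (Prop_irrelevance gZ hZ).
Qed.

(** * Commutator calculus and the ordinal filtration *)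

Section HomK.
Variables (K R : comPzRingType) (f : {rmorphism K -> R}) (U V : lmodType R).
Implicit Types (r c : R) (e : homK f U V).

Definition comm r e : homK f U V := commutator r e.

Lemma commE r e (u : U) : comm r e u = r *: (e u : V) - e (r *: u) :> V.
Proof. by []. Qed.

Definition zero_homK : homK f U V := \0%R.

Definition sub_homK e e' : homK f U V := (e \- e')%R.

Lemma sub_homKE e e' (u : U) : sub_homK e e' u = (e u : V) - e' u :> V.
Proof. by []. Qed.

Definition scale_fun_homK r e (u : restrict f U) : restrict f V :=
  r *: (e u : V).

Fact scale_homK_is_linear r e : linear (scale_fun_homK r e).
Proof.
move=> k x y; rewrite /scale_fun_homK linearP.
have scaleC (a : R) (v w : V) : r *: (a *: v + w) = a *: (r *: v) + r *: w.
  by rewrite scalerDr !scalerA mulrC.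
exact: (scaleC (f k)).
Qed.

HB.instance Definition _ r e := GRing.isLinear.Build K _ _ _
  (scale_fun_homK r e) (scale_homK_is_linear r e).

Definition scale_homK r e : homK f U V := scale_fun_homK r e.

Lemma scale_homKE r e (u : U) : scale_homK r e u = r *: (e u : V) :> V.
Proof. by []. Qed.

Lemma scale_homK1 e : scale_homK 1 e = e.
Proof. by apply: linear_ext => u; rewrite scale_homKE scale1r. Qed.

Lemma scale_homKM r c e : scale_homK (r * c) e = scale_homK r (scale_homK c e).
Proof. by apply: linear_ext => u; exact: (esym (scalerA r c (e u : V))). Qed.

Lemma homKB e (u v : U) : e (u - v : U) = (e u : V) - e v :> V.
Proof. exact: (raddfB e). Qed.

Lemma comm0 r : comm r zero_homK = zero_homK.
Proof. by apply: linear_ext => u; rewrite commE /= subr0 scaler0. Qed.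

Lemma commB r e e' : comm r (sub_homK e e') = sub_homK (comm r e) (comm r e').
Proof.
apply: linear_ext => u.
by rewrite commE !sub_homKE !commE scalerBr !opprD addrACA.
Qed.

Lemma commZ r c e : comm r (scale_homK c e) = scale_homK c (comm r e).
Proof.
apply: linear_ext => u.
by rewrite commE !scale_homKE !commE scalerBr !scalerA mulrC.
Qed.

(* In bimodule notation: [r (s e - e s) = [rs, e] - s [r, e] + [s, [r, e]]]. *)
Lemma scale_comm r s c e : r * s = c ->
  scale_homK r (comm s e) = sub_homK (comm c e)
    (sub_homK (scale_homK s (comm r e)) (comm s (comm r e))).
Proof.
move=> rs; apply: linear_ext => u.
rewrite !sub_homKE !scale_homKE [comm s (comm r e) u]commE opprB.
rewrite [X in _ = _ + X]addrAC subrr add0r !commE scalerBr !scalerA rs.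
by rewrite opprB addrA subrK.
Qed.

Lemma comm_comm r c e : comm r (comm c e) = comm c (comm r e).
Proof.
apply: linear_ext => u.
rewrite !commE !scalerBr !scalerA [c * r]mulrC !opprB.
by rewrite addrACA [RHS]addrACA; congr (_ + _); apply: addrC.
Qed.

(* Forgetting the ordinals makes operators filtered by different well-ordered
   types comparable. *)
Inductive quite : homK f U V -> Prop :=
| quite0 : quite zero_homK
| quiteS e : (forall r, quite (comm r e)) -> quite e.

Lemma quite_comm r e : quite e -> quite (comm r e).
Proof. by case=> [|e' /(_ r)//]; rewrite comm0; apply: quite0. Qed.

Lemma quiteB e e' : quite e -> quite e' -> quite (sub_homK e e').
Proof.
move=> qe; elim: qe e' => [e'|{}e _ IH e' qe'].
  elim=> [|{}e' _ IH].
    have -> : sub_homK zero_homK zero_homK = zero_homK; last exact: quite0.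
    by apply: linear_ext => u; rewrite sub_homKE subr0.
  by apply: quiteS => r; rewrite commB comm0; apply: IH.
by apply: quiteS => r; rewrite commB; apply: IH; apply: quite_comm.
Qed.

Section Filtration.
Variables (d : Order.disp_t) (W : orderType d).
Hypothesis W_wo : well_order (<=%O : rel W).
Implicit Types a b : W.

Lemma well_order_ind (P : W -> Prop) :
  (forall a, (forall b, (b < a)%O -> P b) -> P a) -> forall a, P a.
Proof.
move=> IH a; apply: contrapT => Pa.
pose A : {pred W} := fun b => `[< ~ P b >].
have /W_wo[m [[/asboolP Pm mA] _]] : nonempty A by exists a; apply/asboolP.
apply: Pm; apply: IH => b bm; apply: contrapT => Pb.
have /mA : b \in A by apply/asboolP.
by rewrite leNgt bm.
Qed.

Lemma diff_filt_zero a : diff_filt a zero_homK.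
Proof.
elim/well_order_ind: a => a IH.
have [[b ba]|min_a] := pselect (exists b, (b < a)%O).
  apply: diff_filtS; first by exists b.
  by move=> r; exists b => //; rewrite -/(comm r _) comm0; apply: IH.
apply: diff_filt0 => [b ba|r u]; first by apply: min_a; exists b.
by rewrite -[LHS]/(comm r zero_homK u) comm0.
Qed.

(** The union of the F_b with b < a, with zero adjoined so that it is {0} for a minimal [a]. This
    merges both constructors of [diff_filt] into one condition. *)
Definition below a e : Prop :=
  e = zero_homK \/ exists2 b, (b < a)%O & diff_filt b e.

Lemma diff_filtE a e : diff_filt a e <-> forall r, below a (comm r e).
Proof.
split=> [[{}a {}e _ e0|{}a {}e _ eS] r|ea].
- by left; apply: linear_ext => u; apply: e0.
- by right; apply: eS.
have [[b ba]|min_a] := pselect (exists b, (b < a)%O).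
  apply: diff_filtS => [|r]; first by exists b.
  have [e0|//] := ea r.
  by exists b => //; rewrite -/(comm r e) e0; apply: diff_filt_zero.
apply: diff_filt0 => [b ba|r u]; first by apply: min_a; exists b.
have [e0|[b ba _]] := ea r; last by case: min_a; exists b.
by rewrite -[LHS]/(comm r e u) e0.
Qed.

Lemma below_diff_filt a e : below a e -> diff_filt a e.
Proof.
case=> [->|[b ba /diff_filtE eb]]; first exact: diff_filt_zero.
apply/diff_filtE => r; have [->|[c cb ec]] := eb r; first by left.
by right; exists c => //; apply: lt_trans cb ba.
Qed.

Lemma diff_filt_le a b e : (a <= b)%O -> diff_filt a e -> diff_filt b e.
Proof.
rewrite le_eqVlt => /predU1P[->//|ab ea].
by apply: below_diff_filt; right; exists a.
Qed.

Lemma diff_filt_comm a r e : diff_filt a e -> diff_filt a (comm r e).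
Proof. by move/diff_filtE/(_ r)/below_diff_filt. Qed.

Lemma below_comm a r e : below a e -> below a (comm r e).
Proof.
case=> [->|[b ba eb]]; first by left; rewrite comm0.
by right; exists b => //; apply: diff_filt_comm.
Qed.

Lemma diff_filt_quite a e : diff_filt a e -> quite e.
Proof.
elim/well_order_ind: a e => a IH e /diff_filtE ea.
apply: quiteS => r; have [->|[b ba eb]] := ea r; first exact: quite0.
exact: IH eb.
Qed.

Lemma scale_homK0 c : scale_homK c zero_homK = zero_homK.
Proof. by apply: linear_ext => u; rewrite scale_homKE scaler0. Qed.

Lemma diff_filtZ a c e : diff_filt a e -> diff_filt a (scale_homK c e).
Proof.
elim/well_order_ind: a e => a IH e /diff_filtE ea; apply/diff_filtE => r.
rewrite commZ; have [->|[b ba eb]] := ea r; first by left; apply: scale_homK0.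
by right; exists b => //; apply: IH.
Qed.

Lemma belowZ a c e : below a e -> below a (scale_homK c e).
Proof.
case=> [->|[b ba eb]]; first by left; apply: scale_homK0.
by right; exists b => //; apply: diff_filtZ.
Qed.

(** Closure under subtraction at smaller levels is a hypothesis here, so that the lemma can serve
    inside the induction proving [diff_filtB]. *)
Let belowB_from a :
    (forall b e e', (b < a)%O -> diff_filt b e -> diff_filt b e' ->
       diff_filt b (sub_homK e e')) ->
  forall e e', below a e -> below a e' -> below a (sub_homK e e').
Proof.
move=> IH e e'; have zero_filt := diff_filt_zero.
case=> [->|[b ba eb]] [->|[b' ba' eb']].
- by left; apply: linear_ext => u; rewrite sub_homKE subr0.
- by right; exists b' => //; apply: IH.
- by right; exists b => //; apply: IH.
- right; have [bb'|/ltW b'b] := leP b b'.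
    by exists b' => //; apply: IH => //; apply: diff_filt_le eb.
  by exists b => //; apply: IH => //; apply: diff_filt_le eb'.
Qed.

Lemma diff_filtB a e e' :
  diff_filt a e -> diff_filt a e' -> diff_filt a (sub_homK e e').
Proof.
elim/well_order_ind: a e e' => a IH e e' /diff_filtE ea /diff_filtE ea'.
apply/diff_filtE => r; rewrite commB.
by apply: belowB_from => // b e1 e2 /IH; apply.
Qed.

Lemma belowB a e e' : below a e -> below a e' -> below a (sub_homK e e').
Proof. by apply: belowB_from => b e1 e2 _; apply: diff_filtB. Qed.

End Filtration.

End HomK.

(** * Operators extending a given one, and their uniqueness *)

Section Extension.
Variables (K R S : comPzRingType) (f : {rmorphism K -> R}).
Variables (phi : {rmorphism R -> S}) (U V : lmodType R).
Local Notation US := (base_change phi U).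
Local Notation VS := (base_change phi V).
Local Notation HR := (homK f U V).
Local Notation HS := (homK (phi \o f) US VS).
Local Notation "s ⊗ u" := (btens phi s u) (at level 30).
Implicit Types (e : HR) (E : HS).

Lemma btensDl (M : lmodType R) (s t : S) (u : M) :
  btens phi (s + t) u = btens phi s u + btens phi t u.
Proof. exact: tensDl. Qed.

Lemma btensDr (M : lmodType R) (s : S) (u v : M) :
  btens phi s (u + v) = btens phi s u + btens phi s v.
Proof. exact: tensDr. Qed.

Lemma btensBr (M : lmodType R) (s : S) (u v : M) :
  btens phi s (u - v) = btens phi s u - btens phi s v.
Proof. by apply/eqP; rewrite eq_sym subr_eq -btensDr subrK. Qed.

Lemma btens0 (M : lmodType R) (s : S) : btens phi s (0 : M) = 0.
Proof. by rewrite -(subrr (0 : M)) btensBr subrr. Qed.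

Lemma btensZ (M : lmodType R) (s : S) (r : R) (u : M) :
  btens phi s (r *: u) = btens phi (phi r * s) u.
Proof. exact/esym/tensZ. Qed.

Lemma btens1 (M : lmodType R) (s : S) (u : M) :
  btens phi s u = s *: btens phi 1 u.
Proof. by rewrite scale_btens mulr1. Qed.

Definition extends e E := forall u : U, E (1 ⊗ u) = 1 ⊗ (e u : V) :> VS.

(** This lets inductions over iterated commutators run in parallel over R and S. *)
Lemma extends_comm e E r : extends e E -> extends (comm r e) (comm (phi r) E).
Proof.
move=> eE u; rewrite !commE eE btensBr scale_btens [_ *: (1 ⊗ u)]scale_btens.
by rewrite -!btensZ eE.
Qed.

Hypothesis epi : ring_epi phi.

(** By induction the commutators with [phi r] vanish, so [E] is S-linear by [epi_linear]; it
    vanishes on 1 ⊗ U, which generates. *)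
Lemma quite_extends_zero E :
  quite E -> extends (zero_homK f U V) E -> E = zero_homK _ _ _.
Proof.
elim=> // {}E _ IH E0; apply: linear_ext => x.
have Ephi r (y : US) : E (phi r *: y) = phi r *: (E y : VS) :> VS.
  apply/esym/eqP; rewrite -subr_eq0 -commE IH //.
  by move=> u; rewrite (extends_comm r E0) comm0.
have EZ := epi_linear epi (@homKB _ _ _ _ _ E) Ephi.
elim/base_change_ind: x => [s u|x y Ex Ey].
  by rewrite btens1 EZ E0 /= btens0 scaler0.
by rewrite [LHS]homKB Ex Ey; apply: subrr.
Qed.

Lemma quite_extends_inj e E E' :
  quite E -> quite E' -> extends e E -> extends e E' -> E = E'.
Proof.
move=> qE qE' eE eE'; apply: linear_ext => x.
have /(quite_extends_zero (quiteB qE qE')) EE' :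
    extends (zero_homK f U V) (sub_homK E E').
  by move=> u; rewrite sub_homKE eE eE' subrr /= btens0.
by apply/eqP; rewrite -subr_eq0 -[_ - _]/(sub_homK E E' x) EE'.
Qed.

End Extension.

(** * Construction of an extension with prescribed commutators *)

Lemma ext_ideal_cancel (R S : comPzRingType) (phi : {rmorphism R -> S})
  (I : R -> Prop) (M : lmodType S) (x y : M) :
  ext_ideal phi I 1 -> (forall r, I r -> phi r *: x = phi r *: y) -> x = y.
Proof.
move=> I1 Ixy; rewrite -[x]scale1r -[y]scale1r.
elim: I1 => [t r Ir||s t _ sxy _ txy].
- by rewrite -!scalerA Ixy.
- by rewrite !scale0r.
- by rewrite !scalerBl sxy txy.
Qed.

(* An extension [E] of [e] with commutators [D r] satisfies
   [phi r *: E (s ⊗ u) = D r (s ⊗ u) + 1 ⊗ e (a *: u)] whenever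
   [phi r * s = phi a]; such [r] generate the unit ideal of [S], so these
   equations determine [E (s ⊗ u)]. *)
Section Integrate.
Variables (K R S : comPzRingType) (f : {rmorphism K -> R}).
Variables (phi : {rmorphism R -> S}) (U V : lmodType R).
Local Notation US := (base_change phi U).
Local Notation VS := (base_change phi V).
Local Notation HS := (homK (phi \o f) US VS).
Local Notation "s ⊗ u" := (btens phi s u) (at level 30).

Variables (e : homK f U V) (D : R -> HS).
Hypothesis phi_flat_epi : flat_epi phi.
Hypothesis D_extends : forall r, extends (comm r e) (D r).
Hypothesis D_comm : forall r c, comm (phi r) (D c) = comm (phi c) (D r).

Let scale_e r (v : U) :
  phi r *: (1 ⊗ (e v : V)) = (D r (1 ⊗ v) : VS) + 1 ⊗ (e (r *: v : U) : V).
Proof.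
by rewrite D_extends commE -btensDr subrK scale_btens -btensZ.
Qed.

(** If x c = 0, then x (1 ⊗ e(c u)) = D_x(1 ⊗ c u) + 1 ⊗ e(x c u) = 0, and such [x] generate the
    unit ideal by [flat_ann]. This handles the ambiguity of [a] in [phi r * s = phi a]. *)
Let e_ker c (u : U) : phi c = 0 -> 1 ⊗ (e (c *: u : U) : V) = 0.
Proof.
move=> c0; apply: ext_ideal_cancel (flat_ann phi_flat_epi.2 c0) _ => x xc.
rewrite scaler0 scale_e btensZ c0 mul0r.
rewrite -(mul0r 1) -(rmorph0 phi) -btensZ scale0r btens0.
rewrite scalerA xc scale0r.
rewrite [e _](raddf0 e) btens0 addr0; exact: (raddf0 (D x)).
Qed.

Definition integral_spec (s : S) (u : U) (v : VS) : Prop := forall r a,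
  phi r * s = phi a ->
  phi r *: v = (D r (s ⊗ u) : VS) + 1 ⊗ (e (a *: u : U) : V).

Lemma integral_exists s u : exists v, integral_spec s u v.
Proof.
pose w r a := (D r (s ⊗ u) : VS) + 1 ⊗ (e (a *: u : U) : V).
(* Writing the factor 1 explicitly lets it be generalised to any element of the ideal of
   denominators, so that solutions are built by induction on membership. *)
suff [v vP] : exists v, forall r a,
    phi r * s = phi a -> phi r *: v = 1 *: w r a.
  by exists v => r a /vP ->; rewrite scale1r.
elim: (flat_epi_denom phi_flat_epi.2 phi_flat_epi.1 s) => [t r [a ra]||].
(* It remains to see that phi(r') w(r, a) = phi(r) w(r', a'). The terms in D differ by the two sides
   of [D_comm]; the terms in e agree by [e_ker], as r' a - r a' lies in the kernel of phi. *)
- exists (t *: w r a) => r' a' ra'.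
  rewrite scalerA mulrC -!scalerA; congr (_ *: _); rewrite /w !scalerDr.
  rewrite !scale_e.
  have := congr1 (fun E : HS => E (s ⊗ u) : VS) (D_comm r r').
  rewrite !commE !scale_btens ra ra' -[phi a]mulr1 -[phi a']mulr1 -!btensZ.
  have ker : phi (r' * a - r * a') = 0.
    by rewrite rmorphB !rmorphM -ra -ra' mulrCA subrr.
  have /eqP := e_ker u ker.
  rewrite scalerBl homKB btensBr subr_eq0 !scalerA => /eqP -> /eqP.
  rewrite subr_eq => /eqP ->.
  by rewrite !addrA; congr (_ + _); rewrite addrAC subrK addrC.
- by exists 0 => r a _; rewrite scaler0 scale0r.
- move=> x y _ [v vP] _ [v' vP']; exists (v - v') => r a ra.
  by rewrite scalerBr scalerBl (vP _ _ ra) (vP' _ _ ra).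
Qed.

Definition integral_val (s : restrict phi S^o) (u : U) : VS :=
  projT1 (cid (integral_exists s u)).

Lemma integral_valP s u r a : phi r * s = phi a ->
  phi r *: integral_val s u = (D r (s ⊗ u) : VS) + 1 ⊗ (e (a *: u : U) : V).
Proof. exact: (projT2 (cid (integral_exists s u))). Qed.

Definition integral : US -> VS := tensor_lift integral_val.

Lemma integral_val_unique s u v :
  integral_spec s u v -> integral_val s u = v.
Proof.
move=> vP; have := flat_epi_denom phi_flat_epi.2 phi_flat_epi.1 s.
move/ext_ideal_cancel; apply=> r [a ra].
by rewrite (integral_valP _ ra) (vP _ _ ra).
Qed.

Let valDl u : {morph integral_val^~ u : s t / s + t}.
Proof.
move=> s t.
have denom := flat_epi_denom phi_flat_epi.2 phi_flat_epi.1.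
(* With denominators r of s and q of t, the product q r is a denominator of s, t and s + t. *)
apply: ext_ideal_cancel (denom s) _ => r [a ra].
apply: ext_ideal_cancel (denom t) _ => q [b qb].
rewrite !scalerDr !scalerA -!rmorphM.
have -> := @integral_valP s u (q * r) (q * a); last first.
  by rewrite !rmorphM -mulrA ra.
have -> := @integral_valP t u (q * r) (r * b); last first.
  by rewrite [q * r]mulrC !rmorphM -mulrA qb.
have -> := @integral_valP (s + t) u (q * r) (q * a + r * b); last first.
  rewrite rmorphD mulrDr; congr (_ + _); first by rewrite !rmorphM -mulrA ra.
  by rewrite [q * r]mulrC !rmorphM -mulrA qb.
by rewrite btensDl scalerDl !raddfD btensDr addrACA.
Qed.

Let valDr s : {morph integral_val s : u v / u + v}.
Proof.
move=> u v; apply: integral_val_unique => r a ra.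
rewrite scalerDr !(integral_valP _ ra) btensDr scalerDr !raddfD btensDr.
by rewrite addrACA.
Qed.

Let valZ r s u : integral_val (r *: s) u = integral_val s (r *: u).
Proof.
apply/esym/integral_val_unique => q a qa.
rewrite (@integral_valP _ _ _ (a * r)).
  by rewrite btensZ scalerA.
by rewrite restrict_scaleE rmorphM -qa mulrAC -mulrA.
Qed.

Lemma integralE s u : integral (s ⊗ u) = integral_val s u.
Proof. exact: (tensor_liftE valDl valDr valZ). Qed.

Lemma integral_is_additive : zmod_morphism integral.
Proof. exact: (tensor_lift_is_additive valDl valDr valZ). Qed.

Definition integral_restrict :
  restrict (phi \o f) US -> restrict (phi \o f) VS := integral.

Fact integral_is_linear : linear integral_restrict.
Proof.
move=> k x y; rewrite /integral_restrict.
have intD z t : integral (z + t) = integral z + integral t.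
  have := integral_is_additive (z + t) t.
  by rewrite addrK => ->; rewrite subrK.
rewrite intD; congr (_ + _); rewrite !restrict_scaleE /=.
elim/base_change_ind: x => [s u|z t Hz Ht]; last first.
  by rewrite scalerBr !integral_is_additive Hz Ht scalerBr.
(* The scalar is moved across the tensor onto [u], where the K-linearity of [e] and of [D r]
   applies. *)
rewrite scale_btens !integralE [LHS]valZ.
apply: integral_val_unique => r a ra.
rewrite scalerA mulrC -scalerA (integral_valP _ ra) scalerDr.
congr (_ + _).
  rewrite btensZ -scale_btens; apply/esym.
  exact: (linearZ_LR (D r) k (s ⊗ u : restrict (phi \o f) US)).
have -> : a *: (f k *: u) = f k *: (a *: u) by rewrite !scalerA mulrC.
rewrite [e (f k *: _)](linearZ_LR e k (a *: u : restrict f U)).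
by rewrite restrict_scaleE btensZ scale_btens.
Qed.

HB.instance Definition _ := GRing.isLinear.Build K
  (restrict (phi \o f) US) (restrict (phi \o f) VS) _ integral_restrict
  integral_is_linear.

Definition integral_homK : HS := integral_restrict.

Lemma integral_extends : extends e integral_homK.
Proof.
move=> u; rewrite -[LHS]/(integral _) integralE.
apply: integral_val_unique => r a; rewrite mulr1 => ra.
rewrite scale_e; congr (_ + _); apply/eqP.
by rewrite -subr_eq0 -btensBr -homKB -scalerBl e_ker // rmorphB ra subrr.
Qed.

(** Tested on s ⊗ u after multiplication by a denominator q of s, with phi(q) s = phi(a): then
    phi(q) phi(r) s = phi(r a), and the defining equations reduce the claim to [D_comm]. *)
Lemma comm_integral r : comm (phi r) integral_homK = D r.
Proof.
apply: linear_ext => x.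
elim/base_change_ind: x => [s u|x y Hx Hy]; last first.
  by rewrite [LHS]homKB [RHS]homKB Hx Hy.
rewrite commE -![integral_homK _]/(integral _) scale_btens !integralE.
have denom := flat_epi_denom phi_flat_epi.2 phi_flat_epi.1.
apply: ext_ideal_cancel (denom s) _ => q [a qa].
rewrite scalerBr scalerA mulrC -scalerA (integral_valP _ qa).
rewrite (@integral_valP _ _ q (r * a)); last by rewrite mulrCA qa rmorphM.
have := congr1 (fun E : HS => E (s ⊗ u) : VS) (D_comm q r).
rewrite !commE !scale_btens qa => /eqP; rewrite subr_eq => /eqP ->.
rewrite scalerDr scale_e -[phi a]mulr1 -btensZ scalerA.
by rewrite opprD !addrA [LHS]addrAC addrK addrAC.
Qed.

End Integrate.

(** * Transfinite induction on the order, and the final assembly *)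

Lemma diff_filt_extends (K R S : comPzRingType) (f : {rmorphism K -> R})
  (phi : {rmorphism R -> S}) (phi_flat_epi : flat_epi phi) (U V : lmodType R)
  (d : Order.disp_t) (W : orderType d) (W_wo : well_order (<=%O : rel W))
  (a : W) (e : homK f U V) :
  diff_filt a e ->
  exists2 E : homK (phi \o f) (base_change phi U) (base_change phi V),
    diff_filt a E & extends e E.
Proof.
elim/(well_order_ind W_wo): a e => a IH e /(diff_filtE W_wo) ea.
have /choice[D DP] r : exists Dr : homK (phi \o f) _ _,
    extends (comm r e) Dr /\ below a Dr.
  have [->|[b ba /(IH _ ba)[Dr Drb Dre]]] := ea r.
    by exists (zero_homK _ _ _); split=> [u|]; [rewrite /= btens0|left].
  by exists Dr; split=> //; right; exists b.
have De r := (DP r).1; have Da r := (DP r).2.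
have D_quite r : quite (D r).
  exact: diff_filt_quite (below_diff_filt W_wo (Da r)).
(* Both sides are quite operators extending the same iterated commutator of [e], so uniqueness
   identifies them. *)
have DD r c : comm (phi r) (D c) = comm (phi c) (D r).
  apply: (quite_extends_inj phi_flat_epi.1 (e := comm r (comm c e))).
  - exact: quite_comm.
  - exact: quite_comm.
  - exact: extends_comm.
  - by rewrite comm_comm; apply: extends_comm.
exists (integral_homK phi_flat_epi De DD); last exact: integral_extends.
have := comm_integral phi_flat_epi De DD.
move: (integral_homK _ _ _) => E commE'.
apply/(diff_filtE W_wo) => s.
(* The commutators are known only for elements of [phi R]. For general [s], the factor 1 is
   decomposed into terms t phi(r) with phi(r) s = phi(c), and [scale_comm] expresses phi(r) [s, E]
   through [D c] and [D r]. *)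
rewrite -[comm s E]scale_homK1.
elim: (flat_epi_denom phi_flat_epi.2 phi_flat_epi.1 s) => [t r [c rc]||].
- rewrite scale_homKM (scale_comm E rc).
  apply: (belowZ W_wo); apply: (belowB W_wo); first by rewrite commE'.
  rewrite commE'.
  by apply: (belowB W_wo); [apply: belowZ|apply: below_comm].
- by left; apply: linear_ext => x; rewrite scale_homKE scale0r.
- move=> x y _ xa _ ya.
  have -> : scale_homK (x - y) (comm s E) =
      sub_homK (scale_homK x (comm s E)) (scale_homK y (comm s E)).
    by apply: linear_ext => z; rewrite sub_homKE !scale_homKE scalerBl.
  exact: belowB.
Qed.

(** An inhabited well-ordered type, witnessing that the zero map is quite even if [W] is empty. *)
Lemma bool_well_order : well_order (<=%O : rel bool).
Proof.
apply: antisymmetric_well_order => [|A [b bA]]; first exact: le_anti.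
have [A0|A0] := boolP (false \in A); first by exists false; split=> // -[].
exists b; split=> // c cA.
by case: b c bA cA => -[] //; rewrite (negPf A0).
Qed.

Lemma has_order_exists (K R : comPzRingType) (f : {rmorphism K -> R})
  (U V : lmodType R) (d : Order.disp_t) (W : orderType d)
  (W_wo : well_order (<=%O : rel W)) (a : W) (e : homK f U V) :
  diff_filt a e -> exists2 o : option W, has_order e o & order_le o (Some a).
Proof.
move=> ea; have [e0|/existsNP[u eu]] := pselect (forall u, e u = 0).
  by exists None.
pose A : {pred W} := fun b => `[< diff_filt b e >].
have [|m [[/asboolP me mA] _]] := W_wo A; first by exists a; apply/asboolP.
exists (Some m); last by apply: mA; apply/asboolP.
split=> [||b be]; [by exists u; apply/eqP|exact: me|].
by apply: mA; apply/asboolP.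
Qed.

Theorem proposition6p6
  (K R S : comPzRingType) (f : {rmorphism K -> R}) (phi : {rmorphism R -> S})
  (U V : lmodType R) (phi_flat_epi : flat_epi phi)
  (d : Order.disp_t) (W : orderType d) (W_wo : well_order (<=%O : rel W))
  (alpha : option W) (D_R : homK f U V) (D_R_order : has_order D_R alpha) :
  exists D_S : homK (phi \o f) (base_change phi U) (base_change phi V),
    [/\ quite_diff_op D_S,
        forall u : U, D_S (btens phi 1 u) = btens phi 1 (D_R u),
        forall D' : homK (phi \o f) (base_change phi U) (base_change phi V),
          quite_diff_op D' ->
          (forall u : U, D' (btens phi 1 u) = btens phi 1 (D_R u)) ->
          D' =1 D_S
      & exists2 beta : option W, has_order D_S beta & order_le beta alpha].
Proof.
(* A competitor [D'] may be filtered by another well-ordered type; [quite] makes it comparable with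
   the constructed extension. *)
have quite_op E : @quite_diff_op _ _ (phi \o f) (base_change phi U)
    (base_change phi V) E -> quite E.
  by case=> d' [W' [W'_wo [b /(diff_filt_quite W'_wo)]]].
suff [E [Eop Eext Eord]] :
    exists E : homK (phi \o f) (base_change phi U) (base_change phi V),
    [/\ quite_diff_op E, extends D_R E
      & exists2 beta : option W, has_order E beta & order_le beta alpha].
  exists E; split=> // D' /quite_op D'q D'ext.
  by rewrite (quite_extends_inj phi_flat_epi.1 D'q (quite_op _ Eop) D'ext Eext).
(* Order -1 is treated apart: [D_R] is zero and so is its extension. *)
case: alpha D_R_order => [a [_ Da _]|D0]; last first.
  exists (zero_homK _ _ _); split; last by exists None.
    exists _, bool; split; first exact: bool_well_order.
    by exists true; apply: diff_filt_zero bool_well_order _.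
  by move=> u; rewrite D0 /= btens0.
have [E Ea Eext] := diff_filt_extends phi_flat_epi W_wo Da.
exists E; split=> //; first by exists d, W; split=> //; exists a.
exact: has_order_exists Ea.
Qed.
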